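(* Let $A\subset\mathbb{R}^N$ be nonempty and closed, and let the triple $(U,f,l)$ satisfy condition $(h)''$ relative to $A$. Define $H:[0,\infty)\times\mathbb{R}^N\times\mathbb{R}^N\to\mathbb{R}$ by $$H(t,x,p)=\sup_{u\in U(t)}\{\langle p,f(t,x,u)\rangle-l(t,x,u)\}.$$ Then $H$ satisfies condition $(h)''_H$ relative to $A$. Moreover, if $(U,f,l)$ satisfies (OPC), then $H$ satisfies $(\mathrm{OPC})_H$. Additionally, $(U,f,l)$ is an epigraphical representation of $H$, i.e. for all $t\in[0,\infty)$ and $x\in\mathbb{R}^N$, $$\mathrm{gph}\,H^*(t,x,\cdot)\subset (f,l)(t,x,U(t))\subset \mathrm{epi}\,H^*(t,x,\cdot),$$ where $(f,l)(t,x,u)=(f(t,x,u),l(t,x,u))$.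
   Context: $\mathbb{B}$ denotes the closed unit ball, $\mathbb{B}(x,r)$ the closed ball of radius $r$ centered at $x$, $\mathbb{S}$ the unit sphere, $\mathrm{bd}$ the boundary. For $H$ convex in the last variable, $H^*(t,x,v)=\sup_{p\in\mathbb{R}^N}\{\langle v,p\rangle-H(t,x,p)\}\in\mathbb{R}\cup\{+\infty\}$, $\mathrm{dom}\,H^*(t,x,\cdot)=\{v:H^*(t,x,v)<+\infty\}$, $\mathrm{gph}$ and $\mathrm{epi}$ denote graph and epigraph (over the effective domain). $\mathscr{L}_{\rm loc}$ is the set of $\varphi\in L^1_{\rm loc}([0,\infty);[0,\infty))$ with $\lim_{\sigma\to0}\theta_\varphi(\sigma)=0$, where $\theta_\varphi(\sigma)=\sup\{\int_I\varphi(\tau)d\tau : I$ a compact subinterval of $[0,\infty)$ of length $\le\sigma\}$. Condition $(h)''$ for $(U,f,l)$ relative to $A$: $U:[0,\infty)\rightsquigarrow\mathbb{R}^M$ is a measurable set-valued map with nonempty closed images, $f:[0,\infty)\times\mathbb{R}^N\times\mathbb{R}^M\to\mathbb{R}^N$, $l:[0,\infty)\times\mathbb{R}^N\times\mathbb{R}^M\to\mathbb{R}$, and: (h1) $f,l$ are Lebesgue measurable in $t$ for all $(x,u)$, continuous in $(x,u)$ for all $t$, and there is $\phi\in L^1([0,\infty);\mathbb{R})$ with $l(t,x,u)\ge\phi(t)$ for all $t,x,u$; (h2) $|f(t,x,u)|+|l(t,x,u)|\le c(t)(1+|x|)$ for all $t$, $x$, $u\in U(t)$, for some $c\in L^1_{\rm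 loc}([0,\infty);[0,\infty))$; (h3) for each $t$, the set-valued map $x\rightsquigarrow(f,l)(t,x,U(t))$ is continuous (in the Hausdorff sense) with closed images; (h4) for all $t,x$ the set $\{(f(t,x,u),l(t,x,u)+r):u\in U(t),r\ge0\}$ is convex; (h5) $|f(t,x,u)|+|l(t,x,u)|\le q(t)$ for all $t$, $x\in\mathrm{bd}A$, $u\in U(t)$, for some $q\in\mathscr{L}_{\rm loc}$; (h6) $|f(t,x,u)-f(t,y,u)|+|l(t,x,u)-l(t,y,u)|\le k(t)|x-y|$ for all $t$, $x,y$, $u\in U(t)$, for some $k\in\mathscr{L}_{\rm loc}$. Condition $(h)''_H$ for $H:[0,\infty)\times\mathbb{R}^N\times\mathbb{R}^N\to\mathbb{R}$ relative to $A$: (H1) $H$ is measurable in $t$, continuous in $x$, convex in $p$; (H2) $H(t,x,0)\le-\phi(t)$ for all $t,x$, for some $\phi\in L^1([0,\infty);\mathbb{R})$; and there exist $\lambda:[0,\infty)\times\mathbb{R}^N\to[0,\infty)$ measurable in $t$ and continuous in $x$, $c\in L^1_{\rm loc}([0,\infty);[0,\infty))$ and $k,q\in\mathscr{L}_{\rm loc}$ such that: (H3) $\lambda(t,x)\le c(t)(1+|x|)$ for all $x$ and $\lambda(t,x)\le q(t)$ for all $x\in\mathrm{bd}A$, for all $t$; (H4) $|\lambda(t,x)-\lambda(t,y)|\le k(t)|x-y|$; (H5) $|H(t,x,p)-H(t,y,p)|\le k(t)(1+|p|)|x-y|$; (H6) $|H(t,x,p)-H(t,x,q)|\le\lambda(t,x)|p-q|$;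 (H7) $|H^*(t,x,v)|\le\lambda(t,x)$ for all $v\in\mathrm{dom}\,H^*(t,x,\cdot)$ (all for all $t\ge0$ and $x,y,p,q\in\mathbb{R}^N$). Normal cones: $T_A(x)=\{\zeta:\liminf_{\tau\to0+}\mathrm{dist}(x+\tau\zeta,A)/\tau=0\}$; regular normal cone $N_A(x)=\{\xi:\langle\zeta,\xi\rangle\le0\ \forall\zeta\in T_A(x)\}$; limiting normal cone $\mathbb{N}_A(x)=\{\xi:\exists x_n\to x$ with $x_n\in A$, $\xi_n\to\xi$, $\xi_n\in N_A(x_n)\}$. For $y\in\mathbb{R}^N$, $\eta>0$: $\mathbb{N}^1_{y,\eta}=\{n\in\mathbb{S}: n\in\mathrm{cl}\,\mathrm{conv}\,\mathbb{N}_A(x)$ for some $x\in\mathrm{bd}A\cap\mathbb{B}(y,\eta)\}$. (OPC): there exist $\eta>0,r>0,M\ge0$ such that for almost all $t\ge0$, any $y\in\mathrm{bd}A+\eta\mathbb{B}$ and any $v\in f(t,y,U(t))$ with $\inf_{n\in\mathbb{N}^1_{y,\eta}}\langle n,v\rangle\le0$, there is $w\in f(t,y,U(t))\cap\mathbb{B}(v,M)$ with $\inf_{n\in\mathbb{N}^1_{y,\eta}}\min\{\langle n,w\rangle,\langle n,w-v\rangle\}\ge r$. $(\mathrm{OPC})_H$ is the same condition with $f(t,y,U(t))$ replaced by $\mathrm{dom}\,H^*(t,y,\cdot)$ (both for $v$ and $w$). *)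

(* Defs.v *)
(* R : realType stands for the real numbers,
   R^N is represented by row vectors 'rV[R]_N, equipped with the Euclidean
   inner product and Euclidean norm defined below.  Time t ranges over
   [0,+oo[; all time-dependent data are total functions on R, and all
   hypotheses/conclusions are only imposed for t >= 0. *)
From mathcomp Require Import all_boot all_order all_algebra.
From mathcomp Require Import all_classical all_reals all_analysis.

Set Implicit Arguments.
Unset Strict Implicit.
Unset Printing Implicit Defensive.

Import Order.TTheory GRing.Theory Num.Theory.
Import numFieldNormedType.Exports.

Local Open Scope classical_set_scope.
Local Open Scope ring_scope.

Section Defs.
Variable R : realType.

(* the (completed) Lebesgue measure on R; its sigma-algebra is the
   sigma-algebra of Lebesgue measurable sets *)
Definition Lmu := (@completed_lebesgue_measure R).

Definition Lmeasurable_set (D : set R) : Prop :=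
  measurable (D : set (caratheodory_type (R:=R) (wlength (R:=R) idfun)^*%mu)).

Definition Lmeasurable_fun (D : set R) (g : R -> R) : Prop :=
  measurable_fun (D : set (caratheodory_type (R:=R) (wlength (R:=R) idfun)^*%mu)) g.

Definition L1 (g : R -> R) : Prop :=
  Lmu.-integrable `[0, +oo[ (EFin \o g).

Definition L1loc_nonneg (g : R -> R) : Prop :=
  (forall t, 0 <= t -> 0 <= g t) /\
  (forall T, 0 <= T -> Lmu.-integrable `[0, T] (EFin \o g)).

(* g belongs to the class \mathscr{L}_loc:  g in L^1_loc([0,oo);[0,oo))
   and theta_g(sigma) -> 0 as sigma -> 0, where theta_g(sigma) is the sup
   of int_I g over compact subintervals I of [0,oo) of length <= sigma
   (written out in epsilon-delta form; theta_g is nonnegative and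
   nondecreasing). *)
Definition Lloc (g : R -> R) : Prop :=
  L1loc_nonneg g /\
  forall e, 0 < e -> exists s, 0 < s /\
    forall a b, 0 <= a -> a <= b -> b - a <= s ->
      (\int[Lmu]_(t in `[a, b]) (g t)%:E <= e%:E)%E.

Definition dotp (n : nat) (u v : 'rV[R]_n) : R := \sum_(i < n) u 0 i * v 0 i.

Definition enorm (n : nat) (u : 'rV[R]_n) : R := Num.sqrt (dotp u u).

Definition cball (n : nat) (x : 'rV[R]_n) (r : R) : set 'rV[R]_n :=
  [set y | enorm (y - x) <= r].

Definition pdist (n : nat) (a b : 'rV[R]_n * R) : R :=
  Num.sqrt (enorm (a.1 - b.1) ^+ 2 + (a.2 - b.2) ^+ 2).

Definition bd (n : nat) (A : set 'rV[R]_n) : set 'rV[R]_n :=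
  closure A `\` interior A.

Definition dist_set (n : nat) (y : 'rV[R]_n) (A : set 'rV[R]_n) : R :=
  inf [set enorm (y - a) | a in A].

(* contingent (Bouligand) tangent cone:
   liminf_{tau -> 0+} dist(x + tau z, A) / tau = 0
   (the quotient is nonnegative, so this says: for all e, d > 0 there is
   tau in ]0,d[ with dist(x + tau z, A) / tau < e) *)
Definition Tcone (n : nat) (A : set 'rV[R]_n) (x : 'rV[R]_n) : set 'rV[R]_n :=
  [set z | forall e d, 0 < e -> 0 < d ->
     exists tau, 0 < tau /\ tau < d /\ dist_set (x + tau *: z) A / tau < e].

Definition Ncone (n : nat) (A : set 'rV[R]_n) (x : 'rV[R]_n) : set 'rV[R]_n :=
  [set xi | forall z, Tcone A x z -> dotp z xi <= 0].

Definition LNcone (n : nat) (A : set 'rV[R]_n) (x : 'rV[R]_n) : set 'rV[R]_n :=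
  [set xi | exists (xs xis : nat -> 'rV[R]_n),
     (forall k, A (xs k)) /\ xs @ \oo --> x /\ xis @ \oo --> xi /\
     (forall k, Ncone A (xs k) (xis k))].

Definition conv_hull (n : nat) (S : set 'rV[R]_n) : set 'rV[R]_n :=
  [set z | exists (k : nat) (w : 'I_k -> R) (p : 'I_k -> 'rV[R]_n),
     (forall i, 0 <= w i) /\ \sum_(i < k) w i = 1 /\ (forall i, S (p i)) /\
     z = \sum_(i < k) w i *: p i].

Definition N1 (n : nat) (A : set 'rV[R]_n) (y : 'rV[R]_n) (eta : R)
  : set 'rV[R]_n :=
  [set nu | enorm nu = 1 /\
     exists x, bd A x /\ cball y eta x /\ closure (conv_hull (LNcone A x)) nu].

Definition fatten (n : nat) (S : set ('rV[R]_n * R)) (e : R) : set ('rV[R]_n * R) :=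
  [set z | exists s, S s /\ pdist z s <= e].

Definition Hausdorff_continuous (n : nat) (F : 'rV[R]_n -> set ('rV[R]_n * R)) : Prop :=
  forall x e, 0 < e -> exists d, 0 < d /\
    forall y, enorm (y - x) < d -> F y `<=` fatten (F x) e /\ F x `<=` fatten (F y) e.

Definition convex_pairs (n : nat) (S : set ('rV[R]_n * R)) : Prop :=
  forall a b (th : R), S a -> S b -> 0 <= th -> th <= 1 ->
    S (th *: a.1 + (1 - th) *: b.1, th * a.2 + (1 - th) * b.2).

Section Control.
Variables (N M : nat).
Variable A : set 'rV[R]_N.
Variable U : R -> set 'rV[R]_M.
Variable f : R -> 'rV[R]_N -> 'rV[R]_M -> 'rV[R]_N.
Variable l : R -> 'rV[R]_N -> 'rV[R]_M -> R.

Definition fl_image (t : R) (x : 'rV[R]_N) : set ('rV[R]_N * R) :=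
  [set (f t x u, l t x u) | u in U t].

Definition U_measurable_closed : Prop :=
  (forall t, 0 <= t -> U t !=set0 /\ closed (U t)) /\
  (forall O : set 'rV[R]_M, open O ->
     Lmeasurable_set [set t | 0 <= t /\ U t `&` O !=set0]).

Definition h1 : Prop :=
  (forall x u, Lmeasurable_fun `[0, +oo[ (fun t => l t x u) /\
               forall j : 'I_N, Lmeasurable_fun `[0, +oo[ (fun t => f t x u 0 j)) /\
  (forall t, 0 <= t ->
     continuous (fun xu : 'rV[R]_N * 'rV[R]_M => f t xu.1 xu.2) /\
     continuous (fun xu : 'rV[R]_N * 'rV[R]_M => l t xu.1 xu.2)) /\
  (exists phi, L1 phi /\ forall t x u, 0 <= t -> phi t <= l t x u).

Definition h2 : Prop :=
  exists c, L1loc_nonneg c /\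
    forall t x u, 0 <= t -> U t u ->
      enorm (f t x u) + `|l t x u| <= c t * (1 + enorm x).

Definition h3 : Prop :=
  forall t, 0 <= t ->
    Hausdorff_continuous (fl_image t) /\ (forall x, closed (fl_image t x)).

Definition h4 : Prop :=
  forall t x, 0 <= t ->
    convex_pairs [set (f t x u, l t x u + r) | u in U t & r in [set r : R | 0 <= r]].

Definition h5 : Prop :=
  exists q, Lloc q /\
    forall t x u, 0 <= t -> bd A x -> U t u ->
      enorm (f t x u) + `|l t x u| <= q t.

Definition h6 : Prop :=
  exists k, Lloc k /\
    forall t x y u, 0 <= t -> U t u ->
      enorm (f t x u - f t y u) + `|l t x u - l t y u| <= k t * enorm (x - y).

Definition cond_h : Prop :=
  U_measurable_closed /\ h1 /\ h2 /\ h3 /\ h4 /\ h5 /\ h6.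

Definition Ham (t : R) (x p : 'rV[R]_N) : R :=
  sup [set dotp p (f t x u) - l t x u | u in U t].

Definition OPC : Prop :=
  exists eta r Mc : R, 0 < eta /\ 0 < r /\ 0 <= Mc /\
    {ae Lmu, forall t : R, 0 <= t ->
      forall y, (exists b, bd A b /\ enorm (y - b) <= eta) ->
      forall v, (f t y @` U t) v ->
      (ereal_inf [set (dotp nu v)%:E | nu in N1 A y eta] <= 0)%E ->
      exists w, (f t y @` U t) w /\ cball v Mc w /\
        (r%:E <= ereal_inf [set (Num.min (dotp nu w) (dotp nu (w - v)))%:E
                           | nu in N1 A y eta])%E}.

End Control.

Section Hamiltonian.
Variable N : nat.
Variable A : set 'rV[R]_N.
Variable H : R -> 'rV[R]_N -> 'rV[R]_N -> R.

Definition Hconj (t : R) (x v : 'rV[R]_N) : \bar R :=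
  ereal_sup [set (dotp v p - H t x p)%:E | p in [set: 'rV[R]_N]].

Definition domHconj (t : R) (x : 'rV[R]_N) : set 'rV[R]_N :=
  [set v | (Hconj t x v < +oo)%E].

Definition H1 : Prop :=
  (forall x p, Lmeasurable_fun `[0, +oo[ (fun t => H t x p)) /\
  (forall t p, 0 <= t -> continuous (fun x => H t x p)) /\
  (forall t x, 0 <= t -> forall p q (th : R), 0 <= th -> th <= 1 ->
     H t x (th *: p + (1 - th) *: q) <= th * H t x p + (1 - th) * H t x q).

Definition H2 : Prop :=
  exists phi, L1 phi /\ forall t x, 0 <= t -> H t x 0 <= - phi t.

Definition H3_7 : Prop :=
  exists (lam : R -> 'rV[R]_N -> R) (c k q : R -> R),
    (forall t x, 0 <= t -> 0 <= lam t x) /\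
    (forall x, Lmeasurable_fun `[0, +oo[ (fun t => lam t x)) /\
    (forall t, 0 <= t -> continuous (lam t)) /\
    L1loc_nonneg c /\ Lloc k /\ Lloc q /\
    (forall t x, 0 <= t -> lam t x <= c t * (1 + enorm x)) /\
    (forall t x, 0 <= t -> bd A x -> lam t x <= q t) /\
    (forall t x y, 0 <= t -> `|lam t x - lam t y| <= k t * enorm (x - y)) /\
    (forall t x y p, 0 <= t ->
       `|H t x p - H t y p| <= k t * (1 + enorm p) * enorm (x - y)) /\
    (forall t x p q, 0 <= t -> `|H t x p - H t x q| <= lam t x * enorm (p - q)) /\
    (forall t x v, 0 <= t -> domHconj t x v ->
       (`|Hconj t x v| <= (lam t x)%:E)%E).

Definition cond_hH : Prop := H1 /\ H2 /\ H3_7.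

Definition OPC_H : Prop :=
  exists eta r Mc : R, 0 < eta /\ 0 < r /\ 0 <= Mc /\
    {ae Lmu, forall t : R, 0 <= t ->
      forall y, (exists b, bd A b /\ enorm (y - b) <= eta) ->
      forall v, domHconj t y v ->
      (ereal_inf [set (dotp nu v)%:E | nu in N1 A y eta] <= 0)%E ->
      exists w, domHconj t y w /\ cball v Mc w /\
        (r%:E <= ereal_inf [set (Num.min (dotp nu w) (dotp nu (w - v)))%:E
                           | nu in N1 A y eta])%E}.

Definition gph_Hconj (t : R) (x : 'rV[R]_N) : set ('rV[R]_N * R) :=
  [set z | domHconj t x z.1 /\ Hconj t x z.1 = z.2%:E].

Definition epi_Hconj (t : R) (x : 'rV[R]_N) : set ('rV[R]_N * R) :=
  [set z | domHconj t x z.1 /\ (Hconj t x z.1 <= z.2%:E)%E].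

End Hamiltonian.

End Defs.

(* Main.v *)
(* The function lambda(t,x) = sup_{u in U(t)} (|f| + |l|) serves in (H3)-(H7), and
   the Lipschitz bounds are those of suprema of uniformly close families.
   For measurability in t, the set where the supremum over U(t) exceeds a is
   written with countable operations only: by compactness, a maximiser in the
   closed set U(t) may be replaced by a bounded sequence of rational points that
   approach U(t) and are almost maximal, so no measurable selection is needed.
   The epigraphical representation separates (v, H^*(t,x,v)) from the closed
   convex set (f,l)(t,x,U(t)) + {0} x [0,oo), which is the epigraph of H^*(t,x,.)
   on its domain.  Hence dom H^*(t,x,.) = f(t,x,U(t)), which turns (OPC) into
   (OPC)_H and gives (H7). *)
Require Import Defs.
From mathcomp Require Import all_boot all_order all_algebra.
From mathcomp Require Import all_classical all_reals all_analysis.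
From mathcomp Require Import measurable_realfun ring lra.
Import Order.TTheory GRing.Theory Num.Theory.
Import numFieldNormedType.Exports.
Local Open Scope classical_set_scope.
Local Open Scope ring_scope.

Set Implicit Arguments.
Unset Strict Implicit.
Unset Printing Implicit Defensive.

(** * Euclidean inner product and norm on row vectors *)

Section Euclidean.
Context {R : realType}.

Lemma dotpC n (u v : 'rV[R]_n) : dotp u v = dotp v u.
Proof. by apply: eq_bigr => i _; rewrite mulrC. Qed.

Lemma dotpDl n (u v w : 'rV[R]_n) : dotp (u + v) w = dotp u w + dotp v w.
Proof. by rewrite -big_split; apply: eq_bigr => i _; rewrite mxE mulrDl. Qed.

Lemma dotpZl n (a : R) (u w : 'rV[R]_n) : dotp (a *: u) w = a * dotp u w.
Proof. by rewrite /dotp mulr_sumr; apply: eq_bigr => i _; rewrite mxE mulrA. Qed.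

Lemma dotpNl n (u w : 'rV[R]_n) : dotp (- u) w = - dotp u w.
Proof. by rewrite -scaleN1r dotpZl mulN1r. Qed.

Lemma dotpBl n (u v w : 'rV[R]_n) : dotp (u - v) w = dotp u w - dotp v w.
Proof. by rewrite dotpDl dotpNl. Qed.

Lemma dotpDr n (u v w : 'rV[R]_n) : dotp w (u + v) = dotp w u + dotp w v.
Proof. by rewrite !(dotpC w) dotpDl. Qed.

Lemma dotpZr n (a : R) (u w : 'rV[R]_n) : dotp w (a *: u) = a * dotp w u.
Proof. by rewrite !(dotpC w) dotpZl. Qed.

Lemma dotpBr n (u v w : 'rV[R]_n) : dotp w (u - v) = dotp w u - dotp w v.
Proof. by rewrite !(dotpC w) dotpBl. Qed.

Lemma dotp0l n (w : 'rV[R]_n) : dotp 0 w = 0.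
Proof. by rewrite -(scale0r 0) dotpZl mul0r. Qed.

Lemma dotp_sqrB n (u v : 'rV[R]_n) :
  dotp (u - v) (u - v) = dotp u u - 2 * dotp u v + dotp v v.
Proof. by rewrite dotpBl !dotpBr (dotpC v u); ring. Qed.

Lemma dotp_ge0 n (u : 'rV[R]_n) : 0 <= dotp u u.
Proof. by apply: sumr_ge0 => i _; rewrite -expr2 sqr_ge0. Qed.

Lemma sqr_coord_le_dotp n (u : 'rV[R]_n) i : u 0 i ^+ 2 <= dotp u u.
Proof.
rewrite /dotp (bigD1 i) //= -expr2 lerDl.
by apply: sumr_ge0 => j _; rewrite -expr2 sqr_ge0.
Qed.

Lemma dotp_eq0 n (u : 'rV[R]_n) : dotp u u = 0 -> u = 0.
Proof.
move=> u0; apply/rowP => i; rewrite mxE; apply/eqP; rewrite -sqrf_eq0.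
by rewrite eq_le sqr_ge0 andbT -u0 sqr_coord_le_dotp.
Qed.

Lemma enorm_ge0 n (u : 'rV[R]_n) : 0 <= enorm u.
Proof. exact: sqrtr_ge0. Qed.

Lemma sqr_enorm n (u : 'rV[R]_n) : enorm u ^+ 2 = dotp u u.
Proof. by rewrite sqr_sqrtr // dotp_ge0. Qed.

Lemma enorm0 n : enorm (0 : 'rV[R]_n) = 0.
Proof. by rewrite /enorm dotp0l sqrtr0. Qed.

Lemma enormN n (u : 'rV[R]_n) : enorm (- u) = enorm u.
Proof. by rewrite /enorm dotpNl dotpC dotpNl opprK. Qed.

Lemma coord_le_enorm n (u : 'rV[R]_n) i : `|u 0 i| <= enorm u.
Proof. by rewrite -sqrtr_sqr ler_wsqrtr // sqr_coord_le_dotp. Qed.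

Lemma CauchySchwarz_dotp n (u v : 'rV[R]_n) : dotp u v <= enorm u * enorm v.
Proof.
have [v0|v_neq0] := eqVneq (dotp v v) 0.
  by rewrite (dotp_eq0 v0) dotpC dotp0l mulr_ge0 // enorm_ge0.
have v_gt0 : 0 < dotp v v by rewrite lt_neqAle eq_sym v_neq0 dotp_ge0.
apply: le_trans (ler_norm _) _.
rewrite -ler_sqr ?nnegrE ?mulr_ge0 ?enorm_ge0 //.
rewrite exprMn !sqr_enorm real_normK ?num_real //.
(* Up to the factor [dotp v v], this vector is the component of [u] orthogonal to [v]; its square
   expands to [b * (a * b - c ^+ 2)], and [b > 0] cancels. *)
have := dotp_ge0 (dotp v v *: u - dotp u v *: v).
rewrite dotpBl !dotpBr !dotpZl !dotpZr (dotpC v u).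
set a := dotp u u; set b := dotp v v; set c := dotp u v => h.
have : 0 <= b * (a * b - c ^+ 2).
  by apply: le_trans h _; rewrite le_eqVlt; apply/orP; left; apply/eqP; ring.
by rewrite pmulr_rge0 // subr_ge0.
Qed.

Lemma norm_dotp_le n (u v : 'rV[R]_n) : `|dotp u v| <= enorm u * enorm v.
Proof.
rewrite ler_norml CauchySchwarz_dotp andbT lerNl -dotpNl.
by rewrite -(enormN u) CauchySchwarz_dotp.
Qed.

Lemma ler_enormD n (u v : 'rV[R]_n) : enorm (u + v) <= enorm u + enorm v.
Proof.
rewrite -ler_sqr ?nnegrE ?addr_ge0 ?enorm_ge0 // sqrrD !sqr_enorm.
rewrite dotpDl !dotpDr (dotpC v u); have := CauchySchwarz_dotp u v; lra.
Qed.

Lemma ler_dist_enorm n (u v : 'rV[R]_n) : `|enorm u - enorm v| <= enorm (u - v).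
Proof.
have := ler_enormD (u - v) v; have := ler_enormD (v - u) u.
rewrite !subrK -(opprB u v) enormN ler_norml => ? ?.
by apply/andP; split; lra.
Qed.

Lemma continuous_dotp n (T : topologicalType) (F G : T -> 'rV[R]_n) :
  continuous F -> continuous G -> continuous (fun x => dotp (F x) (G x)).
Proof.
move=> cF cG x; apply: cvg_big => [|i _]; first exact: add_continuous.
by apply: cvgM; [move: (cF x)|move: (cG x)] => h;
  apply: (cvg_comp _ (fun M : 'rV[R]_n => M 0 i) h); exact: coord_continuous.
Qed.

Lemma continuous_enorm n (T : topologicalType) (F : T -> 'rV[R]_n) :
  continuous F -> continuous (fun x => enorm (F x)).
Proof.
move=> cF x.
apply: (cvg_comp (fun y => dotp (F y) (F y)) Num.sqrt); last exact: sqrt_continuous.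
exact: continuous_dotp.
Qed.

(** Links Euclidean estimates to the topology of ['rV[R]_n], which comes from coordinatewise balls:
    [enorm] is continuous for it, so the Lipschitz bound tends to 0. *)
Lemma lipschitz_enorm_continuous n (F : 'rV[R]_n -> R) (C : R) :
  (forall x y, `|F x - F y| <= C * enorm (x - y)) -> continuous F.
Proof.
move=> lipF; suff cF (x : 'rV[R]_n) : F @ nbhs x --> F x by exact: cF.
have cC : (fun y : 'rV[R]_n => C * enorm (x - y)) @ x --> 0.
  have -> : 0 = C * enorm (x - x) by rewrite subrr enorm0 mulr0.
  have c : continuous (fun y : 'rV[R]_n => enorm (x - y)).
    apply: continuous_enorm => y.
    by apply: (@cvgB _ _ _ (nbhs y) _ (cst x) id); [exact: cvg_cst|exact: cvg_id].
  by apply: (@cvgM _ _ (nbhs x) _ (cst C)); [exact: cvg_cst|exact: c].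
apply/cvgrPdist_le => e e0.
move/cvgrPdist_le : cC => /(_ e e0); apply: filterS => y /=.
rewrite sub0r normrN => h; apply: le_trans (lipF _ _) _.
exact: le_trans (ler_norm _) h.
Qed.

End Euclidean.

(** * Measurability of suprema over a measurable closed-valued map *)

Section SupMeasurable.
Context {R : realType}.

Lemma rat_row_dense n (u : 'rV[R]_n) (e : R) : 0 < e ->
  exists q : 'rV[rat]_n, ball u e (map_mx ratr q).
Proof.
move=> e0.
have /choice[q hq] (i : 'I_n) :
    exists q : rat, ratr q \in `](u 0 i - e), (u 0 i + e)[.
  by apply: rat_in_itvoo; lra.
exists (\row_i q i); split=> // i j; rewrite (ord1 i) !mxE.
have := hq j; rewrite in_itv /= /ball /= distrC ltr_distl; lra.
Qed.

Lemma compact_box n (m : R) :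
  compact [set v : 'rV[R]_n | forall i, `|v 0 i| <= m].
Proof.
have := @rV_compact R n (fun=> `[(- m), m]%classic) (fun=> @segment_compact R _ _).
by congr (compact _); apply/seteqP; split => v /= h i; have := h i;
  rewrite in_itv /= ler_norml.
Qed.

Section Parametric.
Context d (T : measurableType d) (D : set T) (n : nat).
Variables (U : T -> set 'rV[R]_n) (g : T -> 'rV[R]_n -> R).
Hypothesis mD : measurable D.
Hypothesis Uclosed : forall t, D t -> closed (U t).
Hypothesis mU : forall O, open O -> measurable [set t | D t /\ U t `&` O !=set0].
Hypothesis mg : forall u, measurable_fun D (g^~ u).
Hypothesis cg : forall t, D t -> continuous (g t).

Let e (j : nat) : R := j.+1%:R^-1.

Let ratrow (q : 'rV[rat]_n) : 'rV[R]_n := map_mx ratr q.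

(** Here [m] bounds the points so that they cluster, [e k] is a fixed margin above [a] that keeps
    the inequality strict in the limit, and [e j] is a tolerance tending to 0. *)
Let approx (a : R) (m k j : nat) (q : 'rV[rat]_n) : set T :=
  [set t | [/\ D t, forall i, `|ratrow q 0 i| <= m%:R,
     U t `&` ball (ratrow q) (e j) !=set0
     & a + e k - e j < g t (ratrow q)]].

Let e_gt0 j : 0 < e j. Proof. by rewrite invr_gt0. Qed.

Let e_lt (x : R) : 0 < x -> exists J, forall j, (J <= j)%N -> e j < x.
Proof.
move=> x0; have [J _ hJ] := near_infty_natSinv_lt (PosNum x0).
by exists J => j /hJ.
Qed.

Let measurable_approx a m k j q : measurable (approx a m k j q).
Proof.
have [hq|nq] := pselect (forall i, `|ratrow q 0 i| <= m%:R); last first.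
  rewrite (_ : approx _ _ _ _ _ = set0) //.
  by apply/seteqP; split => t //= -[].
have -> : approx a m k j q =
    [set t | D t /\ U t `&` ball (ratrow q) (e j) !=set0] `&`
    (D `&` (g^~ (ratrow q)) @^-1` `]a + e k - e j, +oo[).
  apply/seteqP; split => t /=; rewrite in_itv /= andbT.
    by case.
  by move=> [[? ?] [? ?]].
apply: measurableI; first by apply: mU; exact: ball_open.
exact: mg.
Qed.

(* Bounded approximate maximisers [q] with rational coordinates cluster at a
   point of the closed set [U t]; this replaces a measurable selection. *)
Let superlevelE a :
  [set t | D t /\ exists2 u, U t u & a < g t u] =
  \bigcup_m \bigcup_k \bigcap_j \bigcup_q approx a m k j q.
Proof.
apply/seteqP; split => t /=.
- move=> [Dt [u Uu au]].
  have [k ak] := ltr_add_invr au.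
  pose s : R := \sum_i `|u 0 i| + 1.
  have s0 : 0 <= s by rewrite addr_ge0 // sumr_ge0.
  exists (Num.bound s) => //; exists k => // j _.
  have : nbhs u [set y | a + e k < g t y].
    have := @cg t Dt u => /cvgrPdist_lt /(_ (g t u - (a + e k))).
    rewrite subr_gt0 => /(_ ak); apply: filterS => y /=.
    by move/(le_lt_trans (ler_norm _)); lra.
  rewrite -nbhs_ballE => -[r /= r0 hr].
  (* Radius [r] keeps the value above [a + e k], radius 1 keeps [q] in the box of size [s], and
     [e j] keeps [q] close to [u], a point of [U t]. *)
  have [q hq] : exists q : 'rV[rat]_n,
      ball u (Num.min r (Num.min 1 (e j))) (ratrow q).
    by apply: rat_row_dense; rewrite !lt_min r0 ltr01 e_gt0.
  exists q => //; split => //.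
  + move=> i; apply: ltW; apply: le_lt_trans (archi_boundP s0).
    have [_ /(_ 0 i)] := hq; rewrite /ball /= !lt_min => /and3P[_ h1 _].
    rewrite /s (bigD1 i) //=.
    have : 0 <= \sum_(j0 < n | j0 != i) `|u 0 j0| by exact: sumr_ge0.
    have := ler_normB (u 0 i) (u 0 i - ratrow q 0 i).
    by rewrite subKr; lra.
  + exists u; split => //; apply/ball_sym/(le_ball _ hq).
    by rewrite !ge_min lexx !orbT.
  + have : a + e k < g t (ratrow q).
      by apply: hr; apply: le_ball hq; rewrite ge_min lexx.
    by have := e_gt0 j; lra.
- move=> [m _ [k _ h]].
  have /choice[q hq] j : exists q, approx a m k j q t.
    by have [q] := h j Logic.I; exists q.
  have Dt : D t by have [] := hq 0.
  split=> //.
  pose x j : 'rV[R]_n := ratrow (q j).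
  have [|u [_ clu]] := compact_box (n := n) (m := m%:R) (F := x @ \oo) _.
    by exists 0 => // j _; have [_] := hq j.
  (* Every neighbourhood of a cluster point contains terms of arbitrarily large index, hence of
     arbitrarily small tolerance; no subsequence is extracted. *)
  have near_u (V : set 'rV[R]_n) J : nbhs u V -> exists2 j, (J <= j)%N & V (x j).
    move=> uV.
    have [|y [[j Jj <-] Vy]] := clu [set x j | j in [set j | (J <= j)%N]] V _ uV.
      by exists J => // j Jj; exists j.
    by exists j.
  exists u.
    apply: (Uclosed Dt) => V; rewrite -nbhs_ballE => -[r /= r0 hr].
    have r2 : 0 < r / 2 by rewrite divr_gt0.
    have [J hJ] := e_lt r2.
    have [j Jj xj] := near_u _ J (nbhsx_ballx u _ r2).
    have [_ _ [y [Uy xy]] _] := hq j.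
    exists y; split => //; apply: hr; rewrite (splitr r).
    apply: ball_triangle xj _; apply: le_ball xy; exact/ltW/hJ.
  (* The limit yields only a weak inequality; the margin [e k] makes it strict. *)
  apply: lt_le_trans (_ : a + e k <= _); first by rewrite ltrDl.
  apply/ler_addgt0Pr => r r0.
  have r2 : 0 < r / 2 by rewrite divr_gt0.
  have [J hJ] := e_lt r2.
  have : nbhs u [set y | g t y < g t u + r / 2].
    have := @cg t Dt u => /cvgrPdist_lt /(_ _ r2); apply: filterS => y /=.
    by rewrite distrC => /(le_lt_trans (ler_norm _)); lra.
  move=> /(near_u _ J)[j /hJ ej /= gj].
  by have [_ _ _] := hq j; rewrite -/(x j); lra.
Qed.

(** The rays []a, +oo[] generate the Borel sets, and a supremum exceeds [a] exactly when some value
    does. Nonemptiness and boundedness make the real-valued [sup] a true supremum. *)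
Lemma measurable_fun_sup_image :
  (forall t, D t -> U t !=set0) ->
  (forall t, D t -> has_ubound (g t @` U t)) ->
  measurable_fun D (fun t => sup (g t @` U t)).
Proof.
move=> U0 Uub _.
apply: (measurability _ (RGenOInfty.measurableE R)) => //.
move=> _ [_ [a ->] <-].
have -> : D `&` (fun t => sup (g t @` U t)) @^-1` `]a, +oo[ =
    [set t | D t /\ exists2 u, U t u & a < g t u].
  apply/seteqP; split => t /=; rewrite in_itv /= andbT => -[Dt].
    move=> /sup_gt[|_ [u Uu <-] au]; last by split => //; exists u.
    by have [u Uu] := U0 _ Dt; exists (g t u), u.
  move=> [u Uu au]; split => //; apply: lt_le_trans au _.
  by apply: ub_le_sup; [exact: Uub|exists u].
rewrite superlevelE.
apply: bigcupT_measurable => m; apply: bigcupT_measurable => k.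
apply: bigcapT_measurable => j; apply: countable_bigcupT_measurable => //.
Qed.

End Parametric.
End SupMeasurable.

(** * Nearest point and separation for the epigraph of a compact set of pairs *)

Section Separation.
Context {R : realType} (n : nat).
Variable K : set ('rV[R]_n * R).

Lemma closed_bounded_compact_pairs (C : R) : closed K ->
  (forall a, K a -> enorm a.1 <= C /\ `|a.2| <= C) -> compact K.
Proof.
move=> Kcl KC.
apply: (subclosed_compact Kcl
  (compact_setX (@compact_box R n C) (@segment_compact R (- C) C))) => a /KC[a1 a2].
split => /= [i|]; first exact: le_trans (coord_le_enorm _ _) a1.
by rewrite in_itv /= -ler_norml.
Qed.

(* The nearest point to [(v, b)] in the epigraph of [K] is
   [(a.1, max a.2 b)] for the minimiser [a] over [K] of the function [g] below. *)
Lemma support_bound_attained (v : 'rV[R]_n) (b : R) (C : R) :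
  K !=set0 -> closed K ->
  (forall a, K a -> enorm a.1 <= C /\ `|a.2| <= C) ->
  convex_pairs [set (a.1, a.2 + r) | a in K & r in [set r : R | 0 <= r]] ->
  (forall p c, (forall a, K a -> dotp p a.1 - a.2 <= c) -> dotp v p - c <= b) ->
  exists2 a, K a & a.1 = v /\ a.2 <= b.
Proof.
move=> K0 Kcl KC Kcv Kb.
pose g (a : 'rV[R]_n * R) : R :=
  dotp (a.1 - v) (a.1 - v) + Num.max (a.2 - b) 0 ^+ 2.
have cg : continuous g.
  move=> a; apply: (@cvgD _ _ _ (nbhs a)).
    have c : continuous (fun a : 'rV[R]_n * R => a.1 - v).
      by move=> y; apply: (@cvgB _ _ _ (nbhs y) _ fst (cst v));
        [exact: cvg_fst|exact: cvg_cst].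
    exact: (continuous_dotp c c).
  have c : (fun a : 'rV[R]_n * R => Num.max (a.2 - b) 0) @ a --> Num.max (a.2 - b) 0.
    apply: (@continuous_max _ _ (fun a => a.2 - b) (cst 0)); last exact: cvg_cst.
    by apply: (@cvgB _ _ _ (nbhs a) _ snd (cst b)); [exact: cvg_snd|exact: cvg_cst].
  exact: (cvgM c c).
have [a /set_mem Ka amin] :=
  compact_EVT_min K0 (closed_bounded_compact_pairs Kcl KC)
    (continuous_subspaceT cg).
have {}amin a' : K a' -> g a <= g a' by move=> /mem_set; exact: amin.
(* The vector [(p, - s)] leads from the nearest point [(a.1, b + s)] to [(v, b)]; it is the normal
   of the separating hyperplane. *)
pose p := v - a.1; pose s := Num.max (a.2 - b) 0.
have s_ge0 : 0 <= s by rewrite le_max lexx orbT.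
have gaE : g a = dotp p p + s ^+ 2.
  by rewrite /g /p -opprB dotpNl dotpC dotpNl opprK.
have sep a' : K a' ->
    dotp p a'.1 - s * a'.2 <= dotp p v - s * b - (dotp p p + s ^+ 2).
  move=> Ka'.
  pose w := a'.1 - a.1; pose y := a'.2 - b - s.
  suff : dotp p w - s * y <= 0.
    by rewrite /w /y /p !dotpBl !dotpBr; lra.
  (* Convexity places in the epigraph the point at parameter [th] on the way from [(a.1, b + s)] to
     [a']. Minimality of [a], after expanding the squares and dividing by [th], gives the bound. *)
  have quad th : 0 < th -> th <= 1 ->
      2 * (dotp p w - s * y) <= th * (dotp w w + y ^+ 2).
    move=> th0 th1.
    have Ea' : [set (a.1, a.2 + r) | a in K & r in [set r : R | 0 <= r]]
        (a'.1, a'.2) by exists a' => //; exists 0; rewrite /= ?addr0.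
    have Ea : [set (a.1, a.2 + r) | a in K & r in [set r : R | 0 <= r]]
        (a.1, b + s).
      exists a => //; exists (b + s - a.2); last by rewrite addrC subrK.
      have : a.2 - b <= s by rewrite le_max lexx.
      by rewrite /=; lra.
    have [a'' Ka'' [r /= r0 [e1 e2]]] := Kcv _ _ th Ea' Ea (ltW th0) th1.
    have := amin _ Ka''; rewrite gaE /g e1 => h.
    have h2 : Num.max (a''.2 - b) 0 ^+ 2 <= (th * y + s) ^+ 2.
      have -> : th * y + s = a''.2 + r - b by rewrite e2 /y; ring.
      have [ab|ab] := leP (a''.2 - b) 0; first by rewrite expr0n sqr_ge0.
      by rewrite ler_sqr ?nnegrE; lra.
    have : th *: a'.1 + (1 - th) *: a.1 - v = th *: w - p.
      by apply/rowP => i; rewrite /w /p !mxE; ring.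
    move=> e3; move: h; rewrite e3 (dotp_sqrB (th *: w)) !dotpZl !dotpZr (dotpC w p) => h.
    have : th * (2 * (dotp p w - s * y)) <= th * (th * (dotp w w + y ^+ 2)).
      by move: h h2; rewrite !expr2; lra.
    by rewrite ler_pM2l.
  rewrite leNgt; apply/negP => pos.
  set z := dotp p w - s * y in quad pos.
  set q := dotp w w + y ^+ 2 in quad.
  have q_ge0 : 0 <= q by rewrite addr_ge0 ?dotp_ge0 ?sqr_ge0.
  have zq : 0 < z + q by rewrite ltr_wpDr.
  (* With this parameter the bound reads [2 * z * (z + q) <= z * q], which is impossible for [z > 0]
     and [q >= 0]. *)
  have := quad (z / (z + q)); rewrite divr_gt0 // ler_pdivrMr // mul1r lerDl.
  move=> /(_ isT q_ge0); rewrite mulrAC ler_pdivlMr // => h.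
  have : 0 < z * z by rewrite mulr_gt0.
  have : 0 <= z * q by rewrite mulr_ge0 // ltW.
  by move: h; lra.
have pp0 : 0 <= dotp p p by exact: dotp_ge0.
(* If [s > 0] the hyperplane is not vertical: dividing by [s] gives an affine bound of slope
   [s^-1 *: p] that violates the hypothesis by [(dotp p p + s ^+ 2) / s]. *)
have [s0|s_gt0] := eqVneq s 0; last first.
  have {}s_gt0 : 0 < s by rewrite lt_neqAle eq_sym s_gt0.
  have : dotp v (s^-1 *: p) -
      (dotp (s^-1 *: p) v - b - (dotp p p + s ^+ 2) / s) <= b.
    apply: Kb => a' Ka'.
    rewrite !dotpZl -(ler_pM2l s_gt0) !mulrBr !mulrA divff ?gt_eqF // !mul1r.
    rewrite [_ * _ * s^-1]mulrAC divff ?gt_eqF // mul1r.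
    exact: sep.
  rewrite [dotp v _]dotpC => h.
  have : 0 < (dotp p p + s ^+ 2) / s.
    by rewrite divr_gt0 // ltr_wpDl // exprn_gt0.
  lra.
(* If [s = 0] the hyperplane is vertical. As second components are at least [- C], a steep multiple
   of [p] still gives an admissible affine bound; [m] is chosen so that the hypothesis would yield
   [|b| + 1 <= b]. *)
have pE0 : dotp p p = 0.
  apply/eqP; rewrite eq_le pp0 andbT leNgt; apply/negP => p_gt0.
  have C0 : 0 <= C by have [_ h] := KC _ Ka; exact: le_trans (normr_ge0 _) h.
  pose m := (`|b| + C + 1) / dotp p p.
  have m0 : 0 <= m by rewrite divr_ge0 // !addr_ge0.
  have : dotp v (m *: p) - (m * dotp p v - m * dotp p p + C) <= b.
    apply: Kb => a' Ka'.
    have := sep _ Ka'; rewrite s0 expr0n /= addr0 !mul0r !subr0 => h.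
    have [_ h2] := KC _ Ka'.
    have := ler_wpM2l m0 h; have := ler_norm (- a'.2); rewrite normrN dotpZl; lra.
  rewrite dotpC dotpZl; have -> : m * dotp p p = `|b| + C + 1 by rewrite /m mulfVK // gt_eqF.
  by have := ler_norm b; lra.
exists a => //; split.
  by apply/esym/eqP; rewrite -subr_eq0; apply/eqP/dotp_eq0.
have : a.2 - b <= s by rewrite le_max lexx.
by rewrite s0 subr_le0.
Qed.

End Separation.

(** * Real suprema of bounded families *)

Section SupImage.
Context {R : realType} {T : Type}.
Implicit Types (W : set T) (g h : T -> R).

Lemma le_sup_image W g (B : R) u :
  (forall u, W u -> g u <= B) -> W u -> g u <= sup (g @` W).
Proof.
by move=> gB Wu; apply: ub_le_sup; [exists B => _ [y /gB ? <-]|exists u].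
Qed.

Lemma sup_image_le W g (B : R) :
  W !=set0 -> (forall u, W u -> g u <= B) -> sup (g @` W) <= B.
Proof.
move=> [u Wu] gB; apply: ge_sup; first by exists (g u), u.
by move=> _ [y /gB ? <-].
Qed.

Lemma sup_image_dist W g h (B C e : R) : W !=set0 ->
  (forall u, W u -> g u <= B) -> (forall u, W u -> h u <= C) ->
  (forall u, W u -> `|g u - h u| <= e) ->
  `|sup (g @` W) - sup (h @` W)| <= e.
Proof.
move=> W0 gB hC gh; rewrite ler_distl lerBlDr.
apply/andP; split; apply: sup_image_le => // u Wu.
- by have := gh u Wu; rewrite ler_distl; have := le_sup_image gB Wu; lra.
- by have := gh u Wu; rewrite ler_distl; have := le_sup_image hC Wu; lra.
Qed.

End SupImage.

(** * Bounds, convexity and Lipschitz estimates for the Hamiltonian *)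

Section Hamiltonian.
Context {R : realType} (N M : nat).
Variables (U : R -> set 'rV[R]_M).
Variables (f : R -> 'rV[R]_N -> 'rV[R]_M -> 'rV[R]_N).
Variables (l : R -> 'rV[R]_N -> 'rV[R]_M -> R).

(* The function lambda of (H3)-(H7). *)
Definition speed_bound (t : R) (x : 'rV[R]_N) : R :=
  sup [set enorm (f t x u) + `|l t x u| | u in U t].

Section Bounded.
Hypothesis U0 : forall t, 0 <= t -> U t !=set0.
Hypothesis flb : forall t x, 0 <= t ->
  exists B, forall u, U t u -> enorm (f t x u) + `|l t x u| <= B.

Lemma le_speed_bound t x u : 0 <= t -> U t u ->
  enorm (f t x u) + `|l t x u| <= speed_bound t x.
Proof.
move=> t0 Uu; have [B hB] := flb x t0.
exact: (@le_sup_image _ _ _ (fun u => enorm (f t x u) + `|l t x u|) B).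
Qed.

Lemma speed_bound_le t x B : 0 <= t ->
  (forall u, U t u -> enorm (f t x u) + `|l t x u| <= B) -> speed_bound t x <= B.
Proof. by move=> t0 hB; apply: sup_image_le => //; exact: U0. Qed.

Lemma speed_bound_ge0 t x : 0 <= t -> 0 <= speed_bound t x.
Proof.
move=> t0; have [u Uu] := U0 t0; apply: le_trans (le_speed_bound x t0 Uu).
by rewrite addr_ge0 // enorm_ge0.
Qed.

(** A crude Cauchy-Schwarz bound, uniform in [u], which ensures that the [sup] in [Ham] is a true
    supremum. *)
Lemma hamiltonian_le t x p u : 0 <= t -> U t u ->
  dotp p (f t x u) - l t x u <= (enorm p + 1) * speed_bound t x.
Proof.
move=> t0 Uu; have := le_speed_bound x t0 Uu; have := ler_norm (- l t x u).
have := enorm_ge0 (f t x u); have := normr_ge0 (l t x u); rewrite normrN => h1 h2 h3 h4.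
have h5 : enorm (f t x u) <= speed_bound t x by lra.
have := CauchySchwarz_dotp p (f t x u); have := ler_wpM2l (enorm_ge0 p) h5; lra.
Qed.

Lemma le_Ham t x p u : 0 <= t -> U t u ->
  dotp p (f t x u) - l t x u <= Ham U f l t x p.
Proof.
move=> t0 Uu; apply: (@le_sup_image _ _ _ (fun u => dotp p (f t x u) - l t x u)) Uu => y.
exact: hamiltonian_le.
Qed.

Lemma Ham_le t x p B : 0 <= t ->
  (forall u, U t u -> dotp p (f t x u) - l t x u <= B) -> Ham U f l t x p <= B.
Proof. by move=> t0 hB; apply: sup_image_le => //; exact: U0. Qed.

(** A supremum of functions affine in [p] is convex. *)
Lemma Ham_convex t x p q (th : R) : 0 <= t -> 0 <= th -> th <= 1 ->
  Ham U f l t x (th *: p + (1 - th) *: q) <=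
  th * Ham U f l t x p + (1 - th) * Ham U f l t x q.
Proof.
move=> t0 th0 th1; apply: Ham_le => // u Uu.
have th1' : 0 <= 1 - th by rewrite subr_ge0.
rewrite dotpDl !dotpZl.
have := ler_wpM2l th0 (le_Ham x p t0 Uu).
by have := ler_wpM2l th1' (le_Ham x q t0 Uu); lra.
Qed.

Lemma Ham_lipschitz_p t x p q : 0 <= t ->
  `|Ham U f l t x p - Ham U f l t x q| <= speed_bound t x * enorm (p - q).
Proof.
move=> t0; apply: sup_image_dist => [|u|u|u Uu]; first exact: U0.
- exact: hamiltonian_le.
- exact: hamiltonian_le.
rewrite opprB addrA subrK -dotpBl; apply: le_trans (norm_dotp_le _ _) _.
rewrite mulrC ler_wpM2r ?enorm_ge0 //.
by have := le_speed_bound x t0 Uu; have := normr_ge0 (l t x u); lra.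
Qed.

Section Lipschitz.
Variable k : R -> R.
Hypothesis flk : forall t x y u, 0 <= t -> U t u ->
  enorm (f t x u - f t y u) + `|l t x u - l t y u| <= k t * enorm (x - y).

Lemma speed_bound_lipschitz t x y : 0 <= t ->
  `|speed_bound t x - speed_bound t y| <= k t * enorm (x - y).
Proof.
move=> t0; apply: sup_image_dist => [|u|u|u Uu]; first exact: U0.
- exact: le_speed_bound.
- exact: le_speed_bound.
apply: le_trans (flk x y t0 Uu); rewrite opprD addrACA.
apply: le_trans (ler_normD _ _) _; apply: lerD; first exact: ler_dist_enorm.
exact: ler_dist_dist.
Qed.

Lemma Ham_lipschitz_x t x y p : 0 <= t ->
  `|Ham U f l t x p - Ham U f l t y p| <= k t * (1 + enorm p) * enorm (x - y).
Proof.
move=> t0; apply: sup_image_dist => [|u|u|u Uu]; first exact: U0.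
- exact: hamiltonian_le.
- exact: hamiltonian_le.
rewrite opprD addrACA -dotpBr -opprD.
apply: le_trans (ler_normB _ _) _.
have p0 := enorm_ge0 p.
have h := flk x y t0 Uu.
have := norm_dotp_le p (f t x u - f t y u).
have := ler_wpM2l p0 h; have := mulr_ge0 p0 (normr_ge0 (l t x u - l t y u)).
have := enorm_ge0 (f t x u - f t y u).
lra.
Qed.

End Lipschitz.

(** Fenchel-Young: each [u] competes in the supremum defining [Ham], so [dotp p (f t x u) - Ham U f
    l t x p <= l t x u] for every [p]. *)
Lemma fl_image_sub_epi t x : 0 <= t ->
  fl_image U f l t x `<=` epi_Hconj (Ham U f l) t x.
Proof.
move=> t0 _ [u Uu <-].
have le_l : (Hconj (Ham U f l) t x (f t x u) <= (l t x u)%:E)%E.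
  apply: ge_ereal_sup => _ [p _ <-]; rewrite lee_fin.
  by have := le_Ham x p t0 Uu; rewrite dotpC; lra.
by split => //=; exact: le_lt_trans le_l (ltry _).
Qed.

(** * Epigraphical representation and domain of the conjugate *)

Section Representation.
Variables (t : R) (x : 'rV[R]_N).
Hypothesis t0 : 0 <= t.
Hypothesis fl_closed : closed (fl_image U f l t x).
Hypothesis fl_convex :
  convex_pairs [set (f t x u, l t x u + r) | u in U t & r in [set r : R | 0 <= r]].

(** Testing the conjugate at [p = 0] excludes the value [-oo]. *)
Lemma Hconj_real v : domHconj (Ham U f l) t x v ->
  exists b, Hconj (Ham U f l) t x v = b%:E.
Proof.
rewrite /domHconj /=.
have : ((dotp v 0 - Ham U f l t x 0)%:E <= Hconj (Ham U f l) t x v)%E.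
  by apply: ereal_sup_ubound; exists 0.
by case: (Hconj _ _ _ _) => [b| |] //; exists b.
Qed.

(** Separation yields [u] with [f t x u = v] and [l t x u <= b], where [b] is the conjugate at [v];
    Fenchel-Young gives the reverse inequality. *)
Lemma gph_sub_fl_image :
  gph_Hconj (Ham U f l) t x `<=` fl_image U f l t x.
Proof.
move=> [v b] [/= _ vb].
have [a [u Uu <-] [/= av lb]] : exists2 a, fl_image U f l t x a & a.1 = v /\ a.2 <= b.
  apply: (@support_bound_attained _ _ _ _ _ (speed_bound t x)) => //.
  - by have [u Uu] := U0 t0; exists (f t x u, l t x u), u.
  - move=> _ [u Uu <-] /=; have := le_speed_bound x t0 Uu.
    by have := enorm_ge0 (f t x u); have := normr_ge0 (l t x u); lra.
  - move: fl_convex; congr convex_pairs; apply/seteqP; split => z [].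
      move=> u Uu [r r0 <-]; exists (f t x u, l t x u); first by exists u.
      by exists r.
    by move=> _ [u Uu <-] [r r0 <-]; exists u => //; exists r.
  (* An affine bound of slope [p] has constant at least [Ham U f l t x p], so the conjugate controls
     it. *)
  - move=> p c hc; have Hc : Ham U f l t x p <= c.
      by apply: Ham_le => // u Uu; apply: (hc (_, _)); exists u.
    have : ((dotp v p - Ham U f l t x p)%:E <= b%:E)%E.
      by rewrite -vb; apply: ereal_sup_ubound; exists p.
    by rewrite lee_fin; lra.
have [_ /=] := @fl_image_sub_epi t x t0 (f t x u, l t x u) (ex_intro2 _ _ u Uu erefl).
rewrite av vb lee_fin => bl.
by exists u => //; rewrite av (le_anti (andb_true_intro (conj bl lb))).
Qed.

Lemma Hconj_attained v : domHconj (Ham U f l) t x v ->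
  exists2 u, U t u & f t x u = v /\ Hconj (Ham U f l) t x v = (l t x u)%:E.
Proof.
move=> dv; have [b vb] := Hconj_real dv.
have [|u Uu [fv lb]] := @gph_sub_fl_image (v, b); first by [].
by exists u; rewrite // vb lb.
Qed.

Lemma domHconjE : domHconj (Ham U f l) t x = f t x @` U t.
Proof.
apply/seteqP; split => [v /Hconj_attained[u Uu [fv _]]|_ [u Uu <-]]; first by exists u.
by have [] := @fl_image_sub_epi t x t0 (f t x u, l t x u) (ex_intro2 _ _ u Uu erefl).
Qed.

Lemma Hconj_norm_le v : domHconj (Ham U f l) t x v ->
  (`|Hconj (Ham U f l) t x v| <= (speed_bound t x)%:E)%E.
Proof.
move=> /Hconj_attained[u Uu [_ ->]]; rewrite lee_fin.
by have := le_speed_bound x t0 Uu; have := enorm_ge0 (f t x u); lra.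
Qed.

End Representation.
End Bounded.

(** * Lebesgue measurability in time *)

Section Measurable.
Hypothesis mcU : U_measurable_closed U.
Hypothesis hh1 : h1 f l.
Hypothesis flb : forall t x, 0 <= t ->
  exists B, forall u, U t u -> enorm (f t x u) + `|l t x u| <= B.

Lemma Lmeasurable_sup (g : R -> 'rV[R]_M -> R) :
  (forall u, Lmeasurable_fun `[0, +oo[ (g^~ u)) ->
  (forall t, 0 <= t -> continuous (g t)) ->
  (forall t, 0 <= t -> has_ubound (g t @` U t)) ->
  Lmeasurable_fun `[0, +oo[ (fun t => sup (g t @` U t)).
Proof.
have [Ucl Um] := mcU.
move=> mg cg gub mD; move: (mD).
have D_ge0 (t : R) : `[0, +oo[%classic t = (0 <= t) :> Prop.
  by rewrite /= in_itv /= andbT.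
apply: measurable_fun_sup_image => //.
- by move=> t; rewrite D_ge0 => /Ucl[].
- move=> O /Um; congr measurable.
  by apply/seteqP; split => t /=; rewrite in_itv /= andbT.
- by move=> t; rewrite D_ge0; exact: cg.
- by move=> t; rewrite D_ge0 => /Ucl[].
- by move=> t; rewrite D_ge0; exact: gub.
Qed.

Let Lmeasurable_l x u : Lmeasurable_fun `[0, +oo[ (fun t => l t x u).
Proof. by have [/(_ x u)[]] := hh1. Qed.

Let Lmeasurable_f x u i : Lmeasurable_fun `[0, +oo[ (fun t => f t x u 0 i).
Proof. by have [/(_ x u)[_]] := hh1. Qed.

Let continuous_fu t x : 0 <= t -> continuous (f t x).
Proof.
move=> t0; have [_ [/(_ t t0)[cf _] _]] := hh1.
by have [_ /(_ x)] := continuous_curry cf.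
Qed.

Let continuous_lu t x : 0 <= t -> continuous (l t x).
Proof.
move=> t0; have [_ [/(_ t t0)[_ cl] _]] := hh1.
by have [_ /(_ x)] := continuous_curry cl.
Qed.

Lemma Lmeasurable_speed_bound x : Lmeasurable_fun `[0, +oo[ (speed_bound^~ x).
Proof.
apply: Lmeasurable_sup => [u|t t0|t t0].
- apply: measurable_funD; last first.
    by apply: measurableT_comp; [exact: normr_measurable|exact: Lmeasurable_l].
  have msqrt : measurable_fun setT (@Num.sqrt R).
    by apply: continuous_measurable_fun; exact: sqrt_continuous.
  have mdot : Lmeasurable_fun `[0, +oo[ (fun t => dotp (f t x u) (f t x u)).
    apply: measurable_sum => i.
    by apply: measurable_funM; exact: Lmeasurable_f.
  exact: (measurableT_comp msqrt mdot).
- have cf : continuous (fun u => enorm (f t x u)).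
    by apply: continuous_enorm; exact: continuous_fu.
  have cl : continuous (fun u => `|l t x u|).
    by move=> u; exact: (cvg_norm (@continuous_lu t x t0 u)).
  by move=> u; exact: (cvgD (@cf u) (@cl u)).
- by have [B hB] := flb x t0; exists B => _ [u Uu <-]; exact: hB.
Qed.

Lemma Lmeasurable_Ham x p : Lmeasurable_fun `[0, +oo[ (fun t => Ham U f l t x p).
Proof.
apply: Lmeasurable_sup => [u|t t0|t t0].
- apply: measurable_funB; last exact: Lmeasurable_l.
  apply: measurable_sum => i; apply: measurable_funM; last exact: Lmeasurable_f.
  exact: measurable_cst.
- have cf : continuous (fun u => dotp p (f t x u)).
    apply: (@continuous_dotp _ _ _ (cst p)); last exact: continuous_fu.
    exact: cst_continuous.
  by move=> u; exact: (cvgB (@cf u) (@continuous_lu t x t0 u)).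
- exists ((enorm p + 1) * speed_bound t x) => _ [u Uu <-].
  exact: hamiltonian_le.
Qed.

End Measurable.
End Hamiltonian.

Theorem theorem3p1 (R : realType) (N M : nat) (A : set 'rV[R]_N)
  (U : R -> set 'rV[R]_M)
  (f : R -> 'rV[R]_N -> 'rV[R]_M -> 'rV[R]_N)
  (l : R -> 'rV[R]_N -> 'rV[R]_M -> R) :
  A !=set0 -> closed A -> cond_h A U f l ->
  cond_hH A (Ham U f l) /\
  (OPC A U f -> OPC_H A (Ham U f l)) /\
  (forall t x, 0 <= t ->
     gph_Hconj (Ham U f l) t x `<=` fl_image U f l t x /\
     fl_image U f l t x `<=` epi_Hconj (Ham U f l) t x).
Proof.
move=> _ _ [mcU [hh1 [[c [cL cB]] [hh3 [hh4 [[q [qL qB]] [k [kL kB]]]]]]]].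
have U0 t : 0 <= t -> U t !=set0 by move=> t0; have [/(_ t t0)[]] := mcU.
have flb t x : 0 <= t ->
    exists B, forall u, U t u -> enorm (f t x u) + `|l t x u| <= B.
  by move=> t0; exists (c t * (1 + enorm x)) => u; exact: cB.
have flcl t x : 0 <= t -> closed (fl_image U f l t x).
  by move=> t0; have [_] := hh3 t t0; exact.
have [_ [_ [phi [phiL phiB]]]] := hh1.
split; last split.
- split; [split; [|split]|split].
  + by move=> x p; exact: Lmeasurable_Ham.
  + move=> t p t0.
    apply: (@lipschitz_enorm_continuous _ _ _ (k t * (1 + enorm p))) => x y.
    exact: (Ham_lipschitz_x U0 flb kB).
  + by move=> t x t0 p p' th th0 th1; exact: Ham_convex.
  + exists phi; split => // t x t0; apply: Ham_le => // u Uu.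
    by rewrite dotp0l sub0r lerN2 phiB.
  (* The functions [c], [k] and [q] are those of (h2), (h6) and (h5). *)
  exists (speed_bound U f l), c, k, q; do ! split => //.
  + by move=> t x; exact: speed_bound_ge0.
  + by move=> x; exact: Lmeasurable_speed_bound.
  + move=> t t0; apply: (@lipschitz_enorm_continuous _ _ _ (k t)) => x y.
    exact: (speed_bound_lipschitz U0 flb kB).
  + by move=> t x t0; apply: speed_bound_le => // u; exact: cB.
  + by move=> t x t0 bx; apply: speed_bound_le => // u; exact: qB.
  + by move=> t x y; exact: (speed_bound_lipschitz U0 flb kB).
  + by move=> t x y p; exact: (Ham_lipschitz_x U0 flb kB).
  + by move=> t x p p'; exact: Ham_lipschitz_p.
  + move=> t x v t0; apply: Hconj_norm_le => //; first exact: flcl.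
    exact: hh4.
- move=> [eta [r [Mc [eta0 [r0 [Mc0 opc]]]]]]; exists eta, r, Mc; do 3 split => //.
  (* The constants and the exceptional null set carry over: at each [t >= 0] the two velocity sets
     coincide. *)
  apply: negligibleS opc => t /=; apply: contra_not => opc t0 y yb v.
  have -> := domHconjE U0 flb t0 (flcl t y t0) (hh4 t y t0).
  exact: opc.
- move=> t x t0; split; last exact: fl_image_sub_epi.
  by apply: gph_sub_fl_image => //; [exact: flcl|exact: hh4].
Qed.
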